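(* Let $\mathbb{C}^9$ have basis $\{x_{ij}\}_{1\le i,j\le 3}$ and let $$\det_3=\sum_{\sigma,\tau\in\mathfrak{S}_3}(-1)^\tau x_{\sigma(1)\tau(1)}\otimes x_{\sigma(2)\tau(2)}\otimes x_{\sigma(3)\tau(3)}\in S^3\mathbb{C}^9\subset(\mathbb{C}^9)^{\otimes 3}.$$ Then the Waring border rank of $\det_3$ satisfies $\underline{\mathbf{R}}_S(\det_3)\le 17$.
   Context: A symmetric tensor $T\in S^3\mathbb{C}^m$ has Waring rank one if $T=a\otimes a\otimes a$ for some $a\in\mathbb{C}^m$; the Waring rank is the smallest $r$ such that $T$ is a sum of $r$ tensors of Waring rank one. The Waring border rank $\underline{\mathbf{R}}_S(T)$ is the smallest $r$ such that $T$ is a limit of a sequence of symmetric tensors of Waring rank at most $r$. $(-1)^\tau$ is the sign of $\tau$.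
   Formalization: The sign (-1)^τ in the formula for det_3 is corrected to (-1)^σ(-1)^τ: with (-1)^τ alone the tensor is nonzero and skew-symmetric in the three factors, so it is not in S^3 C^9 and has no Waring border rank. *)

(* Defs.v *)
From HB Require Import structures.
From mathcomp Require Import all_boot all_order all_algebra all_fingroup.
From mathcomp Require Import complex.
From mathcomp Require Import all_classical all_reals all_analysis.
Import Order.TTheory GRing.Theory Num.Theory.
Import numFieldNormedType.Exports.

Set Implicit Arguments.
Unset Strict Implicit.
Unset Printing Implicit Defensive.

Local Open Scope classical_set_scope.
Local Open Scope complex_scope.
Local Open Scope ring_scope.

Definition least (P : nat -> Prop) (r : nat) : Prop :=
  P r /\ forall s : nat, P s -> (r <= s)%N.

(* The space C^I, with coordinates indexed by a finite type I; C^m is the case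
   I = 'I_m, and C^9 with basis x_ij is the case I = 'I_3 * 'I_3. *)
Definition cvec (R : realType) (I : finType) := {ffun I -> R[i]}.

(* (C^I)^{(x) 3}: the coordinate of T at v is its coefficient on
   e_{v 0} (x) e_{v 1} (x) e_{v 2}. *)
Definition tensor3 (R : realType) (I : finType) :=
  {ffun {ffun 'I_3 -> I} -> R[i]}.

(* u 0 (x) u 1 (x) u 2 *)
Definition tens (R : realType) (I : finType) (u : 'I_3 -> cvec R I) :
    tensor3 R I :=
  [ffun v : {ffun 'I_3 -> I} => \prod_(k < 3) u k (v k)].

Definition symmetric_tensor (R : realType) (I : finType) (T : tensor3 R I) :
    Prop :=
  forall (s : 'S_3) (v : {ffun 'I_3 -> I}), T [ffun k => v (s k)] = T v.

Definition waring_rank_one (R : realType) (I : finType) (T : tensor3 R I) :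
    Prop :=
  exists a : cvec R I, T = tens (fun _ => a).

(* "The Waring rank of T is r", as a relation; it has no solution r when T is
   not a sum of tensors of Waring rank one. *)
Definition waring_rank (R : realType) (I : finType) (T : tensor3 R I) :
    nat -> Prop :=
  least (fun r => exists U : 'I_r -> tensor3 R I,
    (forall l, waring_rank_one (U l)) /\ T = \sum_(l < r) U l).

Definition waring_rank_le (R : realType) (I : finType) (T : tensor3 R I)
    (r : nat) : Prop :=
  exists2 k : nat, waring_rank T k & (k <= r)%N.

(* Limits in the finite-dimensional space (C^I)^{(x) 3} are taken
   coordinatewise; the topology of C is carried by the copy R[i]^o of R[i]. *)
Definition tensor_cvg (R : realType) (I : finType) (U : nat -> tensor3 R I)
    (T : tensor3 R I) : Prop :=
  forall v : {ffun 'I_3 -> I},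
    (fun n => U n v : R[i]^o) @ \oo --> (T v : R[i]^o).

(* "The Waring border rank of T is r", as a relation. *)
Definition waring_border_rank (R : realType) (I : finType) (T : tensor3 R I) :
    nat -> Prop :=
  least (fun r => exists U : nat -> tensor3 R I,
    (forall n, symmetric_tensor (U n) /\ waring_rank_le (U n) r) /\
    tensor_cvg U T).

Definition x_ (R : realType) (i j : 'I_3) : cvec R ('I_3 * 'I_3)%type :=
  [ffun p : 'I_3 * 'I_3 => (p == (i, j))%:R].

(* Both signs are needed: with the sign of t alone, the sum over s and t is
   skew-symmetric in the three factors, not symmetric. *)
Definition det3 (R : realType) : tensor3 R ('I_3 * 'I_3)%type :=
  \sum_(s : 'S_3) \sum_(t : 'S_3)
    ((-1) ^+ s * (-1) ^+ t) *: tens (fun k => x_ R (s k) (t k)).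

Lemma det3_symmetric (R : realType) : symmetric_tensor (det3 R).
Proof.
move=> p v; rewrite /det3 !sum_ffunE.
rewrite (reindex_inj (mulgI p)) /=; apply: eq_bigr => s _.
rewrite !sum_ffunE (reindex_inj (mulgI p)) /=; apply: eq_bigr => t _.
have -> : (-1) ^+ (p * s)%g * (-1) ^+ (p * t)%g = (-1) ^+ s * (-1) ^+ t :> R[i].
  by rewrite -!signr_addb !odd_permM addbACA addbb.
rewrite !ffunE; congr (_ *: _); rewrite [RHS](reindex_inj (@perm_inj _ p)) /=.
by apply: eq_bigr => k _; rewrite !ffunE !permM.
Qed.

(* Main.v *)
Require Import Defs.
From mathcomp Require Import all_boot all_order all_algebra all_fingroup.
From mathcomp Require Import ring complex.
From mathcomp Require Import all_classical all_reals all_analysis.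
Import Order.TTheory GRing.Theory Num.Theory.
Import numFieldNormedType.Exports.

Set Implicit Arguments.
Unset Strict Implicit.
Unset Printing Implicit Defensive.

Local Open Scope classical_set_scope.
Local Open Scope ring_scope.

(** Write det_3 = x_00 det Y - r adj(Y) c, where r and c are the rest of the
    first row and of the first column, and give x_00, (r, c), Y the weights
    0, 1, 2.  For 8 linear forms P_k in (r, c), 8 linear forms Y_k in Y and
    weights c_k, the sum
      sum_k c_k ((x_00 + t P_k + t^2 Y_k)^3 + (x_00 - t P_k + t^2 Y_k)^3)
    is even in t.  Its t^0 term is cancelled by a multiple of the 17th cube
    x_00^3, its t^2 term vanishes when sum c_k P_k^2 = 0 and sum c_k Y_k = 0,
    and its t^4 term is a multiple of det_3 when sum c_k Y_k^2 and
    sum c_k P_k^2 Y_k are in the right proportion to det Y and r adj(Y) c.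
    Dividing by t^4 and letting t tend to 0 gives det_3.

    The P_k are u_j(r) + v_j(c) and sqrt(-3) (u_j(r) - v_j(c)), where u_0, ..,
    u_3 are the vertices of a regular tetrahedron in P^1, scaled so that
    sum u_j^2 = 0, and v_j is the conjugate of u_j. *)

Lemma least_exists (P : nat -> Prop) (r : nat) :
  P r -> exists2 k, least P k & (k <= r)%N.
Proof.
move=> Pr; have exP : exists k, `[< P k >] by exists r; apply/asboolP.
case: (ex_minnP exP) => k /asboolP Pk min_k.
exists k; last exact/min_k/asboolP.
by split=> // s Ps; apply/min_k/asboolP.
Qed.

Section WaringBorderRank.
Variables (R : realType) (I J : finType).
Implicit Types (a : J -> cvec R I) (T : tensor3 R I).

Lemma sum_cubes_symmetric a : symmetric_tensor (\sum_j tens (fun=> a j)).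
Proof.
move=> s v; rewrite !sum_ffunE; apply: eq_bigr => j _; rewrite !ffunE.
rewrite [RHS](reindex_inj (@perm_inj _ s)).
by apply: eq_bigr => k _; rewrite ffunE.
Qed.

Lemma waring_rank_le_sum_cubes a :
  waring_rank_le (\sum_j tens (fun=> a j)) #|J|.
Proof.
apply: least_exists; exists (fun l => tens (fun=> a (enum_val l))); split.
  by move=> l; exists (a (enum_val l)).
rewrite (reindex (@enum_val J predT)) //=.
by exists enum_rank => j _; rewrite (enum_valK, enum_rankK).
Qed.

Lemma waring_border_rank_le T (a : nat -> J -> cvec R I) :
  tensor_cvg (fun n => \sum_j tens (fun=> a n j)) T ->
  exists2 r, waring_border_rank T r & (r <= #|J|)%N.
Proof.
move=> cvgT; apply: least_exists.
exists (fun n => \sum_j tens (fun=> a n j)); split=> // n; split.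
  exact: sum_cubes_symmetric.
exact: waring_rank_le_sum_cubes.
Qed.

End WaringBorderRank.

Lemma cvg_add_invn2 (R : realType) (c k : R[i]) :
  (fun n => c + n.+1%:R^-1 ^+ 2 * k : R[i]^o) @ \oo --> (c : R[i]^o).
Proof.
apply/cvgrPdist_lt => e e_gt0.
have [m km] : exists m, `|k| < m%:R * e.
  (* The order of [R[i]] is partial, but [0 < e] forces [e] to be real, so the Archimedean property
     of [R] applies. *)
  move: e_gt0; rewrite ltcE /= => /andP[/eqP im_e re_e].
  exists (Num.bound
    (Num.sqrt (complex.Re k ^+ 2 + complex.Im k ^+ 2) / complex.Re e)).
  have -> : e = (complex.Re e)%:C%C by case: e im_e {re_e} => x y /= ->.
  rewrite -(rmorph_nat (real_complex R)) -rmorphM /= normc_def ltcR.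
  by rewrite -ltr_pdivrMr // archi_boundP // divr_ge0 ?sqrtr_ge0 ?ltW.
near=> n.
rewrite opprD addNKr normrN normrM normrX normfV normr_nat mulrC.
rewrite exprVn ltr_pdivrMr ?exprn_gt0 ?ltr0n// mulrC.
apply: lt_le_trans km _; rewrite ler_pM2r // -natrX ler_nat.
apply: leq_trans (_ : n <= _)%N; first by near: n; exists m.
by rewrite (leq_trans (leqnSn n))// -[leqLHS]expn1 leq_pexp2l.
Unshelve. all: by end_near. Qed.

Lemma sum_S3 (V : zmodType) (F : 'S_3 -> V) :
  \sum_(s : 'S_3) F s =
    F 1%g + F (tperm 0 1) + F (tperm 0 2) + F (tperm 1 2) +
    F (tperm 0%R 1%R * tperm 1%R 2)%g + F (tperm 1%R 2 * tperm 0%R 1%R)%g.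
Proof.
pose r : seq 'S_3 := [:: 1%g; tperm 0 1; tperm 0 2; tperm 1 2;
  (tperm 0%R 1%R * tperm 1%R 2)%g; (tperm 1%R 2 * tperm 0%R 1%R)%g].
have ur : uniq r.
  have inj : injective (fun s : 'S_3 => [seq s i | i <- [:: 0; 1; 2]]).
    move=> s s' [e0 e1 e2]; apply/permP => i.
    by case: i => [[|[|[|]]] //] lt_i; [move: e0|move: e1|move: e2];
      congr (_ = _); congr (fun_of_perm _ _); apply: val_inj.
  by rewrite -(map_inj_uniq inj) /= !permM !permE.
have -> : \sum_(s : 'S_3) F s = \sum_(s <- r) F s.
  rewrite -big_enum; apply: perm_big; apply: uniq_perm; rewrite ?enum_uniq //.
  have [||_ e s] := uniq_min_size ur (s2 := enum 'S_3); last by rewrite e.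
  - by move=> s _; rewrite mem_enum.
  - by rewrite -cardE card_Sn.
by rewrite !big_cons big_nil addr0 !addrA.
Qed.

Section Polarization.
Variable C : comNzRingType.

(** The full polarization of the determinant: it equals 6 det at [X 0 = X 1 = X 2]. *)
Definition polar_det3 (X : 'I_3 -> 'I_3 -> 'I_3 -> C) : C :=
  \sum_(s : 'S_3) \sum_(t : 'S_3)
    (-1) ^+ s * (-1) ^+ t * \prod_(k < 3) X k (s k) (t k).

Lemma sum_even_cubes (K : finType) (c : K -> C) (P Y : K -> 'I_3 -> C)
    (x : 'I_3 -> C) (t : C) :
  \sum_k c k * (\prod_(l < 3) (x l + t * P k l + t ^+ 2 * Y k l) +
                \prod_(l < 3) (x l - t * P k l + t ^+ 2 * Y k l)) =
  2 * (x 0 * x 1 * x 2) * \sum_k c k +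
  2 * t ^+ 2 * (x 0 * x 1 * \sum_k c k * Y k 2 +
                x 0 * x 2 * \sum_k c k * Y k 1 +
                x 1 * x 2 * \sum_k c k * Y k 0 +
                x 0 * \sum_k c k * (P k 1 * P k 2) +
                x 1 * \sum_k c k * (P k 0 * P k 2) +
                x 2 * \sum_k c k * (P k 0 * P k 1)) +
  2 * t ^+ 4 * (x 0 * \sum_k c k * (Y k 1 * Y k 2) +
                x 1 * \sum_k c k * (Y k 0 * Y k 2) +
                x 2 * \sum_k c k * (Y k 0 * Y k 1) +
                \sum_k c k * (P k 0 * P k 1 * Y k 2) +
                \sum_k c k * (P k 0 * P k 2 * Y k 1) +
                \sum_k c k * (P k 1 * P k 2 * Y k 0)) +
  2 * t ^+ 6 * \sum_k c k * (Y k 0 * Y k 1 * Y k 2).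
Proof.
have o1 : lift ord0 ord0 = 1 :> 'I_3 by apply: val_inj.
have o2 : lift ord0 (lift ord0 ord0) = 2 :> 'I_3 by apply: val_inj.
rewrite !(mulrDr, mulr_sumr) -!big_split /=; apply: eq_bigr => k _.
rewrite !big_ord_recl !big_ord0 o1 o2; ring.
Qed.

End Polarization.

Section Tetrahedron.
Variables (C : comNzRingType) (w : C).
Hypothesis w_root : w ^+ 2 = - w - 1.
Implicit Types (k : bool * 'I_4) (X Y Z : 'I_3 -> 'I_3 -> C).

(* 2 w + 1 is a square root of -3. *)
Definition tetra_u (j : 'I_4) (a b : C) : C :=
  if j == 0 then (2 * w + 1) * a else a + w ^+ (2 * j) * b.

(** Over the ring [C], conjugation becomes [w -> w ^+ 2], which negates [2 * w + 1]. *)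
Definition tetra_v (j : 'I_4) (a b : C) : C :=
  if j == 0 then - (2 * w + 1) * a else a + w ^+ j * b.

Definition weight k : C := if k.1 then - 3 else 1.

Definition lin_part k X : C :=
  let u := tetra_u k.2 (X 0 1) (X 0 2) in
  let v := tetra_v k.2 (X 1 0) (X 2 0) in
  2 * (if k.1 then u + v else (2 * w + 1) * (u - v)).

(* [e / 3] runs over the coordinates of the adjugate of the block Y in the
   basis u_j (x) v_j of 2 x 2 matrices, and [X 2 2 + 2 * X 1 1] is the sum of
   the four values of [e]. *)
Definition quad_part k X : C :=
  let e := if k.2 == 0 then X 2 2 - X 1 1
           else X 1 1 - w ^+ (2 * k.2) * X 1 2 - w ^+ k.2 * X 2 1 in
  6 * (- (X 2 2 + 2 * X 1 1) + (-1) ^+ (~~ k.1) * (2 * e)).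

Lemma sum_bool_I4 (V : nmodType) (F : bool * 'I_4 -> V) :
  \sum_k F k = \sum_j F (true, j) + \sum_j F (false, j).
Proof.
by rewrite (eq_bigr (fun k => F (k.1, k.2))) => [|[]//];
  rewrite -(pair_bigA _ (fun b j => F (b, j))) big_bool.
Qed.

Lemma sum_weight : \sum_k weight k = - 8.
Proof.
rewrite sum_bool_I4 !big_ord_recl !big_ord0 /weight /=; ring.
Qed.

Lemma sum_quad X : \sum_k weight k * quad_part k X = 0.
Proof.
rewrite sum_bool_I4 !big_ord_recl !big_ord0 /weight /quad_part /= /bump /=.
ring: w_root.
Qed.

(** As [(2 * w + 1) ^+ 2 = - 3], the mixed u_j v_j terms of the two families cancel; what remains
    are multiples of the polarized sums of u_j^2 and v_j^2, both zero. *)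
Lemma sum_lin2 X Y : \sum_k weight k * (lin_part k X * lin_part k Y) = 0.
Proof.
rewrite sum_bool_I4 !big_ord_recl !big_ord0.
rewrite /weight /lin_part /tetra_u /tetra_v /= /bump /=.
ring: w_root.
Qed.

(** With S the sum of the values e_j of [e], the left side at [X = Y] is 288 (S^2 - sum e_j^2), and
    S^2 - sum e_j^2 = 6 det of the block. *)
Lemma sum_quad2 X Y : \sum_k weight k * (quad_part k X * quad_part k Y) =
  864 * (X 1 1 * Y 2 2 + X 2 2 * Y 1 1 - X 1 2 * Y 2 1 - X 2 1 * Y 1 2).
Proof.
rewrite sum_bool_I4 !big_ord_recl !big_ord0 /weight /quad_part /= /bump /=.
ring: w_root.
Qed.

(** At [X = Y = Z] the S terms vanish as in [sum_lin2], leaving - 576 sum e_j u_j v_j, where sum e_j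
    u_j v_j = 3 r adj(Y) c. *)
Lemma sum_lin2_quad X Y Z :
  \sum_k weight k * (lin_part k X * lin_part k Y * quad_part k Z) =
  - 864 * (X 0 1 * Y 1 0 * Z 2 2 - X 0 1 * Y 2 0 * Z 1 2
         - X 0 2 * Y 1 0 * Z 2 1 + X 0 2 * Y 2 0 * Z 1 1
         + Y 0 1 * X 1 0 * Z 2 2 - Y 0 1 * X 2 0 * Z 1 2
         - Y 0 2 * X 1 0 * Z 2 1 + Y 0 2 * X 2 0 * Z 1 1).
Proof.
rewrite sum_bool_I4 !big_ord_recl !big_ord0.
rewrite /weight /lin_part /quad_part /tetra_u /tetra_v /= /bump /=.
ring: w_root.
Qed.

(** The value 16 cancels twice [sum_weight], the coefficient of t^0. *)
Definition form_weight (i : unit + bool * (bool * 'I_4)) : C :=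
  if i is inr p then weight p.2 else 16.

Definition form (t : C) (i : unit + bool * (bool * 'I_4)) X : C :=
  if i is inr p
  then X 0 0 + (-1) ^+ p.1 * t * lin_part p.2 X + t ^+ 2 * quad_part p.2 X
  else X 0 0.

Lemma sum_form_cubes (t : C) (X : 'I_3 -> 'I_3 -> 'I_3 -> C) :
  \sum_i form_weight i * \prod_(l < 3) form t i (X l) =
  1728 * t ^+ 4 * polar_det3 X +
  2 * t ^+ 6 * \sum_k weight k *
    (quad_part k (X 0) * quad_part k (X 1) * quad_part k (X 2)).
Proof.
have o1 : lift ord0 ord0 = 1 :> 'I_3 by apply: val_inj.
have o2 : lift ord0 (lift ord0 ord0) = 2 :> 'I_3 by apply: val_inj.
rewrite big_sumType (big_pred1 tt) /=; last by case.
pose F (b : bool) k := weight k * \prod_(l < 3)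
  (X l 0 0 + (-1) ^+ b * t * lin_part k (X l) + t ^+ 2 * quad_part k (X l)).
have F_split k : F true k + F false k = weight k * (
    \prod_(l < 3)
      (X l 0 0 + t * lin_part k (X l) + t ^+ 2 * quad_part k (X l)) +
    \prod_(l < 3)
      (X l 0 0 - t * lin_part k (X l) + t ^+ 2 * quad_part k (X l))).
  by rewrite mulrDr addrC; congr (_ * _ + _ * _); apply: eq_bigr => l _; ring.
rewrite -(pair_bigA _ F) big_bool -big_split (eq_bigr _ (fun k _ => F_split k)).
rewrite (sum_even_cubes _ (fun k l => lin_part k (X l))
  (fun k l => quad_part k (X l)) (fun l => X l 0 0)).
rewrite sum_weight !sum_quad !sum_lin2 !sum_quad2 !sum_lin2_quad.
rewrite /polar_det3 !sum_S3 !big_ord_recl !big_ord0.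
rewrite !(odd_permM, odd_perm1, odd_tperm) !permM !permE /= o1 o2.
ring.
Qed.

End Tetrahedron.

Definition unit_matrix (C : nzRingType) (p : 'I_3 * 'I_3) : 'I_3 -> 'I_3 -> C :=
  fun i j => (p == (i, j))%:R.

(** Evaluating at matrix units turns the trilinear identity [sum_form_cubes] into one between tensor
    coordinates. *)
Lemma det3E (R : realType) (v : {ffun 'I_3 -> 'I_3 * 'I_3}) :
  det3 R v = polar_det3 (fun l => unit_matrix R[i] (v l)).
Proof.
rewrite /det3 sum_ffunE; apply: eq_bigr => s _.
rewrite sum_ffunE; apply: eq_bigr => t _; rewrite !ffunE.
by congr (_ * _); apply: eq_bigr => k _; rewrite ffunE.
Qed.

Theorem theorem2p12 (R : realType) :
  exists2 r : nat, waring_border_rank (det3 R) r & (r <= 17)%N.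
Proof.
pose w : R[i] := (sqrtC (- 3) - 1) / 2.
have w_root : w ^+ 2 = - w - 1 by rewrite /w; field: (sqrtCK (- 3 : R[i])).
have <- : #|{: unit + bool * (bool * 'I_4)}| = 17%N.
  by rewrite card_sum !card_prod card_unit card_bool card_ord.
pose t n : R[i] := n.+1%:R^-1.
(* Cube roots absorb the weights and the division by 1728 t^4 into the vectors. *)
pose scale n i : R[i] := 3.-root (form_weight R[i] i / (1728 * t n ^+ 4)).
apply: (waring_border_rank_le (a := fun n i =>
  [ffun p => scale n i * form w (t n) i (unit_matrix R[i] p)])) => v.
rewrite det3E; pose X l := unit_matrix R[i] (v l); set d := polar_det3 _.
pose k : R[i] := \sum_k weight R[i] k *
  (quad_part w k (X 0) * quad_part w k (X 1) * quad_part w k (X 2)).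
(* The error is 2 t^6 k / (1728 t^4) = t^2 k / 864. *)
suff -> : (fun n => (\sum_i tens (fun=> [ffun p =>
    scale n i * form w (t n) i (unit_matrix R[i] p)])) v) =
    (fun n => d + t n ^+ 2 * (k / 864)).
  exact: cvg_add_invn2.
apply/funext => n; rewrite sum_ffunE.
have t_neq0 : t n != 0 by rewrite invr_eq0 pnatr_eq0.
under eq_bigr => i _.
  rewrite ffunE; under eq_bigr do rewrite ffunE.
  rewrite big_split /= prodr_const card_ord rootCK // mulrAC.
  over.
rewrite -mulr_suml (sum_form_cubes w_root _ X) -/d -/k.
by field.
Qed.
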